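(* Consider a packing mixed integer linear program $(\mathrm{P})$, let $\mathcal{J}=\{J_1,\dots,J_q\}$ be a partition of the index set $[n]$ of the columns of $A$, and let $G = G^{\mathrm{pack}}_{A,\mathcal{J}}=(V,E)$ be the packing interaction graph of $A$. Then for any sparse cut support list $\mathcal{V}\subseteq 2^V$, $$z^{\mathcal{V},P}\le \eta^{\mathcal{V}}(G)\cdot z^I .$$
   Context: $[n]=\{1,\dots,n\}$. The packing problem $(\mathrm{P})$ is: maximize $c^Tx$ subject to $Ax\le b$, $x_j\in\mathbb{Z}_+$ for $j\in\mathcal{L}$, $x_j\in\mathbb{R}_+$ for $j\in[n]\setminus\mathcal{L}$, where $A\in\mathbb{Q}_+^{m\times n}$, $b\in\mathbb{Q}_+^m$, $c\in\mathbb{Q}_+^n$, $\mathcal{L}\subseteq[n]$. Let $P$ be its feasible region, $P^I$ the convex hull of $P$, and $P^{LP}$ the feasible region of its linear programming relaxation. Sparse closures: for $N\subseteq[n]$, a sparse cut on $N$ is an inequality $\alpha^Tx\le\beta$ valid for $P^I$ with $\alpha_i=0$ for all $i\notin N$; $P^{(N)}$ is the set of points of $P^{LP}$ satisfying all sparse cuts on $N$. Packing interaction graph $G^{\mathrm{pack}}_{A,\mathcal{J}}$: it has one node $v_j$ for each block $J_j\in\mathcal{J}$, and distinct nodes $v_i,v_j$ are adjacent iff some row of $A$ has a nonzero entry in a column of $J_i$ and a nonzero entry in a column of $J_j$. For $S\subseteq V$ put $P^{(S)}:=P^{(\bigcup_{v_j\in S}J_j)}$. A sparse cut support list is a collection $\mathcal{V}$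 of subsets of $V$; $P^{\mathcal{V},P}:=\bigcap_{S\in\mathcal{V}}P^{(S)}$. Set $z^I=\max\{c^Tx: x\in P^I\}$ and $z^{\mathcal{V},P}=\max\{c^Tx: x\in P^{\mathcal{V},P}\}$. Mixed stable sets: for a simple graph $G=(V,E)$ and a collection $\mathcal{V}$ of subsets of $V$, a collection $\mathcal{M}\subseteq 2^V$ is a mixed stable set subordinate to $\mathcal{V}$ if (1) every set in $\mathcal{M}$ is contained in some set of $\mathcal{V}$; (2) the sets in $\mathcal{M}$ are pairwise disjoint; (3) no edge of $G$ has endpoints in distinct sets of $\mathcal{M}$. Let $\chi_{\mathcal{M}}\in\{0,1\}^V$ be defined by $\chi_{\mathcal{M}}(v)=1$ iff $v$ belongs to some set of $\mathcal{M}$. The fractional mixed chromatic number $\eta^{\mathcal{V}}(G)$ is the minimum of $\sum_{\mathcal{M}}y_{\mathcal{M}}$ subject to $\sum_{\mathcal{M}}y_{\mathcal{M}}\chi_{\mathcal{M}}\ge\mathbf{1}$ (componentwise) and $y_{\mathcal{M}}\ge0$ for all $\mathcal{M}$, where $\mathcal{M}$ ranges over all mixed stable sets subordinate to $\mathcal{V}$. (If $\mathcal{V}$ does not cover $V$ this linear program is infeasible, and the stated bound is regarded as vacuous.) *)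

(* Defs.v *)
From mathcomp Require Import all_boot all_order all_algebra.
From mathcomp Require Import all_classical all_reals all_analysis.

Set Implicit Arguments.
Unset Strict Implicit.
Unset Printing Implicit Defensive.

Import Order.TTheory GRing.Theory Num.Theory.

Local Open Scope classical_set_scope.
Local Open Scope ring_scope.

Definition inner (R : realType) (n : nat) (a x : 'cV[R]_n) : R :=
  (a^T *m x) 0 0.

(* The data of the program are rational; the points live in R^n. *)
Definition packing_region (R : realType) (m n : nat)
    (A : 'M[rat]_(m, n)) (b : 'cV[rat]_m) (L : {set 'I_n}) : set 'cV[R]_n :=
  [set x | [/\ forall i, (map_mx ratr A *m x) i 0 <= ratr (b i 0),
               forall j, j \in L -> x j 0 \is a Num.nat
             & forall j, j \notin L -> 0 <= x j 0]].

Definition lp_region (R : realType) (m n : nat)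
    (A : 'M[rat]_(m, n)) (b : 'cV[rat]_m) : set 'cV[R]_n :=
  [set x | (forall i, (map_mx ratr A *m x) i 0 <= ratr (b i 0)) /\
           (forall j, 0 <= x j 0)].

Definition convex_hull (R : realType) (n : nat) (X : set 'cV[R]_n) :
    set 'cV[R]_n :=
  smallest (@convex_set R 'cV[R]_n) X.

Definition integer_hull (R : realType) (m n : nat)
    (A : 'M[rat]_(m, n)) (b : 'cV[rat]_m) (L : {set 'I_n}) : set 'cV[R]_n :=
  convex_hull (packing_region A b L).

(* The inequality  alpha^T x <= beta  is identified with (alpha, beta). *)
Definition sparse_cut (R : realType) (n : nat) (PI : set 'cV[R]_n)
    (N : {set 'I_n}) (alpha : 'cV[R]_n) (beta : R) : Prop :=
  (forall x, PI x -> inner alpha x <= beta) /\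
  (forall i, i \notin N -> alpha i 0 = 0).

Definition sparse_closure (R : realType) (m n : nat)
    (A : 'M[rat]_(m, n)) (b : 'cV[rat]_m) (L : {set 'I_n})
    (N : {set 'I_n}) : set 'cV[R]_n :=
  [set x | lp_region A b x /\
           forall alpha beta, sparse_cut (integer_hull A b L) N alpha beta ->
             inner alpha x <= beta].

(* The node v_j of the interaction graph is the index j : 'I_q of J_j. *)
Definition block_partition (n q : nat) (J : 'I_q -> {set 'I_n}) : Prop :=
  injective J /\ finset.partition [set J j | j : 'I_q]%SET [set: 'I_n]%SET.

Definition pack_graph (m n q : nat) (A : 'M[rat]_(m, n))
    (J : 'I_q -> {set 'I_n}) : rel 'I_q :=
  fun u v => (u != v) &&
    [exists i, [exists s in J u, A i s != 0] && [exists t in J v, A i t != 0]].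

Definition list_closure (R : realType) (m n q : nat)
    (A : 'M[rat]_(m, n)) (b : 'cV[rat]_m) (L : {set 'I_n})
    (J : 'I_q -> {set 'I_n}) (VV : {set {set 'I_q}}) : set 'cV[R]_n :=
  \bigcap_(S in [set` VV]) sparse_closure A b L (\bigcup_(j in S) J j)%SET.

(* Optimal value of  max c^T x  over X; +oo when the program is unbounded. *)
Definition opt_value (R : realType) (n : nat) (c : 'cV[rat]_n)
    (X : set 'cV[R]_n) : \bar R :=
  ereal_sup [set (inner (map_mx ratr c) x)%:E | x in X].

Definition mixed_stable (T : finType) (e : rel T) (VV M : {set {set T}}) :
    bool :=
  [&& [forall S in M, exists U in VV, S \subset U],
      finset.trivIset M
    & [forall S1 in M, forall S2 in M, (S1 != S2) ==>
        [forall u in S1, forall v in S2, ~~ e u v]]].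

Definition chi (T : finType) (R : realType) (M : {set {set T}}) (v : T) : R :=
  (v \in finset.cover M)%:R.

Definition fractional_mixed_cover (T : finType) (R : realType) (e : rel T)
    (VV : {set {set T}}) (y : {set {set T}} -> R) : Prop :=
  (forall v, 1 <= \sum_(M | mixed_stable e VV M) y M * chi R M v) /\
  (forall M, mixed_stable e VV M -> 0 <= y M).

(* Optimal value of the covering program; +oo when it is infeasible. *)
Definition mixed_chromatic (T : finType) (R : realType) (e : rel T)
    (VV : {set {set T}}) : \bar R :=
  ereal_inf [set (\sum_(M | mixed_stable e VV M) y M)%:E
            | y in fractional_mixed_cover (R := R) e VV].

(* Main.v *)
(* If M is a mixed stable set, the parts of different feasible points supported
   on different members of M can be added up to one feasible point, because no
   row of A meets two members; hence the optima of the programs restricted to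
   the members of M add up to at most z^I. Each such optimum is the right-hand
   side of a sparse cut whose coefficients are those of c, so a point x of the
   sparse closure satisfies c^T x|_M <= z^I. Averaging over a fractional cover
   by mixed stable sets gives the bound. *)
Require Import Defs.
From mathcomp Require Import all_boot all_order all_algebra.
From mathcomp Require Import all_classical all_reals all_analysis.

Import Order.TTheory GRing.Theory Num.Theory.

Set Implicit Arguments.
Unset Strict Implicit.
Unset Printing Implicit Defensive.

Local Open Scope classical_set_scope.
Local Open Scope ring_scope.

(** * Linear functionals, convex hulls and column blocks *)

Lemma innerE (R : realType) (n : nat) (a x : 'cV[R]_n) :
  inner a x = \sum_j a j 0 * x j 0.
Proof. by rewrite /inner mxE; apply: eq_bigr => j _; rewrite mxE. Qed.

Lemma inner_sumr (R : realType) (n : nat) (I : Type) (r : seq I) (P : pred I)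
    (a : 'cV[R]_n) (F : I -> 'cV[R]_n) :
  inner a (\sum_(i <- r | P i) F i) = \sum_(i <- r | P i) inner a (F i).
Proof. by rewrite /inner mulmx_sumr summxE. Qed.

Lemma ler_inner (R : realType) (n : nat) (a x y : 'cV[R]_n) :
  (forall j, 0 <= a j 0) -> (forall j, x j 0 <= y j 0) ->
  inner a x <= inner a y.
Proof. by move=> a0 xy; rewrite !innerE ler_sum// => j _; rewrite ler_wpM2l. Qed.

Lemma halfspace_convex (R : realType) (n : nat) (a : 'cV[R]_n) (beta : R) :
  convex_set [set x : 'cV[R]_n | inner a x <= beta].
Proof.
apply/convex_setW => x y; rewrite !inE /= => ax ay k k0 k1.
have : inner a (k%:num *: (x : 'cV_n) + (1 - k%:num) *: (y : 'cV_n)) <= beta.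
  move: ax ay; rewrite /inner mulmxDr -!scalemxAr !mxE => ax ay.
  rewrite [leRHS](_ : _ = k%:num * beta + (1 - k%:num) * beta); last first.
    by rewrite -mulrDl addrC subrK mul1r.
  by apply: lerD; apply: ler_wpM2l.
exact: mem_set.
Qed.

(** A half-space is convex, so it contains the smallest convex set around [X]. Validity of a cut
    thus needs checking on [P] only. *)
Lemma convex_hull_le (R : realType) (n : nat) (X : set 'cV[R]_n)
    (a : 'cV[R]_n) (beta : R) :
  (forall x, X x -> inner a x <= beta) ->
  forall x, convex_hull X x -> inner a x <= beta.
Proof.
by move=> h; apply: (smallest_sub (@halfspace_convex R n a beta)).
Qed.

Lemma trivIset_sum_mem (R : realType) (T : finType) (M : {set {set T}}) (v : T) :
  finset.trivIset M ->
  \sum_(S in M) (v \in S)%:R = (v \in finset.cover M)%:R :> R.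
Proof.
move=> tM; have [vM|vM] := boolP (v \in finset.cover M); last first.
  rewrite big1// => S SM; case: (boolP (v \in S)) => // vS; case/negP: vM.
  by apply/bigcupP; exists S.
rewrite (bigD1 (finset.pblock M v))/= ?finset.pblock_mem// finset.mem_pblock vM.
rewrite big1 ?addr0// => S /andP[SM /negP ne].
by case: (boolP (v \in S)) => // vS; case: ne; rewrite (finset.def_pblock tM SM vS).
Qed.

(** Replaces the partition by the map from a column to the node of its block. Injectivity of [J] is
    what turns equality of blocks into equality of nodes. *)
Lemma block_partition_index (n q : nat) (J : 'I_q -> {set 'I_n}) :
  block_partition J ->
  exists f : 'I_n -> 'I_q, forall u j, (j \in J u) = (f j == u).
Proof.
move=> [Jinj /and3P[/eqP cov tr _]].
have ex j : exists u, j \in J u.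
  have : j \in [set: 'I_n]%SET by rewrite inE.
  by rewrite -cov => /bigcupP[_ /imsetP[u _ ->] ju]; exists u.
have [f hf] := choice ex.
exists f => u j; apply/idP/eqP => [ju|<-//].
apply: Jinj; apply/eqP/negP => /negP ne.
have /finset.trivIsetP/(_ _ _ _ _ ne) := tr.
move=> /(_ (imset_f _ isT) (imset_f _ isT)) /pred0P/(_ j) /=.
by rewrite ju hf.
Qed.

Definition block_mask (R : realType) (n q : nat) (f : 'I_n -> 'I_q)
    (S : {set 'I_q}) (x : 'cV[R]_n) : 'cV[R]_n :=
  \col_j (x j 0 *+ (f j \in S)).

(** Masking is self-adjoint: the objective at a masked point is a functional with masked
    coefficients, which is the form of a sparse cut. *)
Lemma inner_block_maskC (R : realType) (n q : nat) (f : 'I_n -> 'I_q)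
    (S : {set 'I_q}) (a x : 'cV[R]_n) :
  inner (block_mask f S a) x = inner a (block_mask f S x).
Proof.
by rewrite !innerE; apply: eq_bigr => j _; rewrite !mxE mulrnAl mulrnAr.
Qed.

(** * Gluing feasible points along a mixed stable set *)

Section Packing.
Variables (R : realType) (m n q : nat).
Variables (A : 'M[rat]_(m, n)) (b : 'cV[rat]_m) (L : {set 'I_n}).
Hypothesis hA : forall i j, 0 <= A i j.
Hypothesis hb : forall i, 0 <= b i 0.
Variable J : 'I_q -> {set 'I_n}.
Variable f : 'I_n -> 'I_q.
Hypothesis hf : forall u j, (j \in J u) = (f j == u).

Let P : set 'cV[R]_n := packing_region A b L.
Let mask : {set 'I_q} -> 'cV[R]_n -> 'cV[R]_n := block_mask f.

Lemma packing_ge0 (x : 'cV[R]_n) : P x -> forall j, 0 <= x j 0.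
Proof.
by move=> [_ h1 h2] j; have [/h1/natr_ge0|/h2] := boolP (j \in L).
Qed.

Lemma packing0 : P 0.
Proof.
split=> [i|j _|j _]; rewrite ?mulmx0 mxE ?lexx//.
by rewrite ler0q.
Qed.

(** A row meeting two members of [M] would create an edge between them. So at most one summand
    contributes to each row, and masking it can only decrease the row value, by nonnegativity. *)
Lemma packing_glue (VV M : {set {set 'I_q}}) (p : {set 'I_q} -> 'cV[R]_n) :
  mixed_stable (pack_graph A J) VV M -> (forall S, S \in M -> P (p S)) ->
  P (\sum_(S in M) mask S (p S)).
Proof.
move=> /and3P[_ tM /forall_inP sM] hp.
have nz S : S \in M -> forall j, 0 <= mask S (p S) j 0.
  by move=> SM j; rewrite mxE mulrn_wge0// packing_ge0//; apply: hp.
split=> [i|j jL|j jL]; last 2 first.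
- rewrite summxE rpred_sum// => S SM; rewrite mxE rpredMn//.
  by have [_ + _] := hp S SM; apply.
- by rewrite summxE sumr_ge0// => S SM; apply: nz.
rewrite mulmx_sumr summxE.
(* Row [i] has a nonzero entry in some column whose block belongs to [S]. *)
pose hit (S : {set 'I_q}) := [exists j, (f j \in S) && (A i j != 0)].
have hit0 S : ~~ hit S -> (map_mx ratr A *m mask S (p S)) i 0 = 0.
  move=> /existsPn h; rewrite mxE big1// => j _; rewrite !mxE.
  have := h j; rewrite negb_and negbK => /orP[/negbTE ->|/eqP ->].
    by rewrite mulr0.
  by rewrite raddf0 mul0r.
have [/exists_inP[S SM hS]|/exists_inPn no] := boolP [exists S in M, hit S];
  last first.
  rewrite big1 ?ler0q// => S SM; exact/hit0/no.
rewrite (bigD1 S)//= big1 ?addr0; last first.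
  move=> S' /andP[S'M ne]; apply: hit0; apply/negP => /existsP[j' /andP[j'S' Aj']].
  have /existsP[j /andP[jS Aj]] := hS.
  have := sM _ S'M => /forall_inP/(_ S SM)/implyP/(_ ne).
  move=> /forall_inP/(_ _ j'S')/forall_inP/(_ _ jS)/negP; apply.
  apply/andP; split.
    (* The two nodes are distinct because they lie in disjoint members. *)
    apply/eqP => e; have /finset.trivIsetP/(_ _ _ S'M SM ne)/pred0P/(_ (f j))/= := tM.
    by rewrite jS -e j'S'.
  apply/existsP; exists i; apply/andP; split.
    by apply/exists_inP; exists j'; rewrite ?hf.
  by apply/exists_inP; exists j; rewrite ?hf.
have [+ _ _] := hp S SM => /(_ i); apply: le_trans.
rewrite !mxE ler_sum// => j _; rewrite !mxE ler_wpM2l ?ler0q//.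
by case: (_ \in _); rewrite ?mulr0n ?packing_ge0//; apply: hp.
Qed.

Section Objective.
Variables (c : 'cV[rat]_n) (r : R).
Hypothesis hc : forall j, 0 <= c j 0.
Let cR : 'cV[R]_n := map_mx ratr c.
Hypothesis hr : forall x, P x -> inner cR x <= r.

Let cR_ge0 j : 0 <= cR j 0.
Proof. by rewrite mxE ler0q. Qed.

Let vals S : set R := [set inner cR (mask S x) | x in P].

Let vals_sup S : has_sup (vals S).
Proof.
have le_r x : P x -> inner cR (mask S x) <= r.
  move=> Px; apply: le_trans (hr Px); apply: ler_inner => // j; rewrite mxE.
  by case: (_ \in _); rewrite ?mulr0n ?(packing_ge0 Px).
split; first by exists (inner cR (mask S 0)), 0 => //; exact: packing0.
by exists r => _ [x Px <-]; exact: le_r.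
Qed.

(** Attainment of the suprema is avoided: near-optimal points, one per member, are glued, and the
    total loss is below any [e]. *)
Lemma sum_sup_mask_le (VV M : {set {set 'I_q}}) :
  mixed_stable (pack_graph A J) VV M -> \sum_(S in M) sup (vals S) <= r.
Proof.
move=> hM; apply/ler_addgt0Pr => e e0.
(* The successor keeps the denominator positive when [M] is empty. *)
pose d := e / (#|M|.+1)%:R.
have d0 : 0 < d by rewrite divr_gt0.
have ex S : exists x, P x /\ sup (vals S) - d < inner cR (mask S x).
  by have [_ [x Px <-] h] := sup_adherent d0 (vals_sup S); exists x.
have [p hp] := choice ex.
have := hr (packing_glue hM (fun S _ => (hp S).1)).
rewrite inner_sumr => h.
have : \sum_(S in M) (sup (vals S) - d) <= r.
  by apply: (le_trans _ h); apply: ler_sum => S _; exact/ltW/(hp S).2.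
rewrite sumrB sumr_const lerBlDr => /le_trans; apply; rewrite lerD2l.
by rewrite -mulr_natr /d mulrAC ler_pdivrMr// ler_pM2l// ler_nat.
Qed.

(** For [S] inside [U], the masked objective with right-hand side [sup (vals S)] is a sparse cut on
    the blocks of [U], so [x] satisfies it. *)
Lemma mixed_stable_closure_le (VV M : {set {set 'I_q}}) (x : 'cV[R]_n) :
  mixed_stable (pack_graph A J) VV M -> list_closure A b L J VV x ->
  \sum_(S in M) inner cR (mask S x) <= r.
Proof.
move=> hM hx; apply: (le_trans _ (sum_sup_mask_le hM)).
apply: ler_sum => S SM.
have /and3P[/forall_inP/(_ S SM)/exists_inP[U UVV SU] _ _] := hM.
rewrite -inner_block_maskC; have [_] := hx U UVV; apply; split.
  apply: convex_hull_le => y Py; rewrite inner_block_maskC.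
  by apply: ub_le_sup; [case: (vals_sup S)|exists y].
move=> j jU; rewrite mxE; case: (boolP (f j \in S)) => // fS; case/negP: jU.
by apply/bigcupP; exists (f j); rewrite ?hf//; apply: (fintype.subsetP SU).
Qed.

Lemma fractional_cover_closure_le (VV : {set {set 'I_q}})
    (y : {set {set 'I_q}} -> R) (x : 'cV[R]_n) :
  fractional_mixed_cover (pack_graph A J) VV y ->
  list_closure A b L J VV x -> (forall j, 0 <= x j 0) ->
  inner cR x <= (\sum_(M | mixed_stable (pack_graph A J) VV M) y M) * r.
Proof.
move=> [y1 y0] hx x0.
apply: (@le_trans _ _ (\sum_(M | mixed_stable (pack_graph A J) VV M)
    y M * \sum_(S in M) inner cR (mask S x))); last first.
  rewrite mulr_suml; apply: ler_sum => M hM; rewrite ler_wpM2l ?y0//.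
  exact: mixed_stable_closure_le hM hx.
(* Regroup by columns: disjointness of the members turns the inner sum into [chi], so the total
   weight on column [j] is the coverage of node [f j], at least 1. *)
under eq_bigr => M hM.
  have -> : \sum_(S in M) inner cR (mask S x) =
      \sum_j cR j 0 * x j 0 * chi R M (f j).
    under eq_bigr do rewrite innerE.
    rewrite exchange_big /=; apply: eq_bigr => j _.
    have /and3P[_ tM _] := hM.
    rewrite /chi -trivIset_sum_mem// mulr_sumr; apply: eq_bigr => S _.
    by rewrite mulr_natr [mask _ _ _ _]mxE mulrnAr.
  rewrite mulr_sumr; over.
rewrite exchange_big /= innerE; apply: ler_sum => j _.
under eq_bigr do rewrite mulrCA.
by rewrite -mulr_sumr ler_peMr ?y1// mulr_ge0.
Qed.

End Objective.
End Packing.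

(** * The covering program and its optimal value *)

Lemma singleton_mixed_stable (T : finType) (e : rel T) (VV : {set {set T}})
    (v : T) :
  finset.cover VV = [set: T]%SET ->
  mixed_stable e VV [set [set v]]%SET.
Proof.
move=> hVV; apply/and3P; split.
- apply/forall_inP => S; rewrite inE => /eqP ->.
  have : v \in finset.cover VV by rewrite hVV inE.
  by move=> /bigcupP[U UVV vU]; apply/exists_inP; exists U; rewrite ?finset.sub1set.
- apply/finset.trivIsetP => S1 S2; rewrite !inE => /eqP-> /eqP->.
  by rewrite eqxx.
- apply/forall_inP => S1; rewrite inE => /eqP->.
  by apply/forall_inP => S2; rewrite inE => /eqP->; rewrite eqxx.
Qed.

(** The singleton family at [v] already covers [v]. This feasible point makes the infimum finite. *)
Lemma mixed_cover_exists (T : finType) (R : realType) (e : rel T)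
    (VV : {set {set T}}) :
  finset.cover VV = [set: T]%SET ->
  fractional_mixed_cover e VV (fun=> 1 : R).
Proof.
move=> hVV; split=> // v.
rewrite (bigD1 [set [set v]]%SET) ?singleton_mixed_stable//= mul1r.
by rewrite /chi /finset.cover big_set1 finset.set11 lerDl sumr_ge0.
Qed.

Lemma mixed_cover_sum_ge1 (T : finType) (R : realType) (e : rel T)
    (VV : {set {set T}}) (y : {set {set T}} -> R) (v : T) :
  fractional_mixed_cover e VV y -> 1 <= \sum_(M | mixed_stable e VV M) y M.
Proof.
move=> [/(_ v) y1 y0]; apply: le_trans y1 _; apply: ler_sum => M hM.
by rewrite ler_piMr ?y0// /chi lern1 leq_b1.
Qed.

Lemma mixed_chromatic_ge0 (T : finType) (R : realType) (e : rel T)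
    (VV : {set {set T}}) : (0 <= mixed_chromatic R e VV)%E.
Proof.
apply/ereal_infP => _ [y [_ y0] <-]; rewrite lee_fin.
exact: sumr_ge0.
Qed.

(** For positive [r], divide by [r] and pass to the infimum. For [r = 0], any one cover gives
    [a <= 0]. *)
Lemma le_mixed_chromatic_mul (T : finType) (R : realType) (e : rel T)
    (VV : {set {set T}}) (r a : R) :
  finset.cover VV = [set: T]%SET -> 0 <= r ->
  (forall y, fractional_mixed_cover e VV y ->
     a <= (\sum_(M | mixed_stable e VV M) y M) * r) ->
  (a%:E <= mixed_chromatic R e VV * r%:E)%E.
Proof.
move=> hVV r0 h.
have cov := mixed_cover_exists R e hVV.
have fin : mixed_chromatic R e VV \is a fin_num.
  rewrite ge0_fin_numE ?mixed_chromatic_ge0//.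
  by apply: le_lt_trans (ltry _); apply: ereal_inf_lbound; exists (fun=> 1).
move: r0; rewrite le_eqVlt => /predU1P[r0|r0].
  by rewrite -r0 mule0 lee_fin; have := h _ cov; rewrite -r0 mulr0.
rewrite -lee_pdivrMr//; apply/ereal_infP => _ [y hy <-].
by rewrite -EFinM lee_fin ler_pdivrMr// h.
Qed.

Theorem theorem11 (R : realType) (m n q : nat)
    (A : 'M[rat]_(m, n)) (b : 'cV[rat]_m) (c : 'cV[rat]_n) (L : {set 'I_n})
    (hA : forall i j, 0 <= A i j)
    (hb : forall i, 0 <= b i 0)
    (hc : forall j, 0 <= c j 0)
    (J : 'I_q -> {set 'I_n})
    (hJ : block_partition J)
    (VV : {set {set 'I_q}})
    (hVV : finset.cover VV = [set: 'I_q]%SET) :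
  (opt_value c (list_closure A b L J VV : set 'cV[R]_n)
    <= mixed_chromatic R (pack_graph A J) VV
       * opt_value c (integer_hull A b L : set 'cV[R]_n))%E.
Proof.
have [f hf] := block_partition_index hJ.
set zI := opt_value c (integer_hull A b L).
have zI_ub x : packing_region A b L x ->
    ((inner (map_mx ratr c) x)%:E <= zI)%E.
  by move=> Px; apply: ereal_sup_ubound; exists x => //; exact: sub_gen_smallest.
have zI0 : (0 <= zI)%E.
  have P0 : packing_region A b L (0 : 'cV[R]_n) by exact: packing0.
  apply: le_trans (zI_ub _ P0).
  by rewrite lee_fin innerE sumr_ge0// => j _; rewrite [X in _ * X]mxE mulr0.
have [zIfin|] := boolP (zI \is a fin_num).
  apply/ereal_supP => _ [x hx <-]; rewrite -(fineK zIfin).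
  apply: le_mixed_chromatic_mul => //; first exact: fine_ge0.
  move=> y hy.
  have hr z : packing_region A b L z -> inner (map_mx ratr c) z <= fine zI.
    by move=> /zI_ub; rewrite -{1}(fineK zIfin) lee_fin.
  apply: (fractional_cover_closure_le hA hb hf hc hr hy hx) => j.
  (* Some [U] of the list contains [f j], and the closure for [U] lies in the LP region, whence
     [0 <= x j 0]. *)
  have : f j \in finset.cover VV by rewrite hVV inE.
  by move=> /bigcupP[U UVV _]; have [[_ + _]] := hx U UVV; apply.
rewrite ge0_fin_numE// -leNgt leye_eq => /eqP zIoo.
(* Without columns the objective vanishes, contradicting an infinite [zI]. Otherwise the node [f j0]
   exists and bounds every cover from below. *)
have [j0 _|n0] := pickP 'I_n; last first.
  have : (zI <= 0)%E.
    apply/ereal_supP => _ [x _ <-]; rewrite lee_fin innerE big1// => j.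
    by have := n0 j.
  by rewrite zIoo.
(* eta >= 1 rules out the product 0 * +oo = 0 *)
rewrite zIoo gt0_muley ?leey//; apply: (@lt_le_trans _ _ 1%E) => //.
apply/ereal_infP => _ [y hy <-]; rewrite lee_fin.
exact: mixed_cover_sum_ge1 (f j0) hy.
Qed.
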